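(* Let $k, n, q, r$ be positive integers and let $H = H_{n,q}$ be the Hamming graph. 1. If $q = 2$ and $n = 2^r$, then $\chi_c(H) = \chi_i(H) = n$. 2. If $q$ is a prime power and $n = (q^k - 1)/(q - 1)$, then $\chi_i(H) = q^k$. 3. If $p, q$ are prime powers with $q^k \leq p$, and $m = \frac{p^r - 1}{p - 1}\cdot\frac{q^k - 1}{q - 1}$, then $\chi_i(H_{m,q}) \leq p^r$.
   Context: The Hamming graph $H_{n,q}$ has vertex set $[q]^n = \{1,\dots,q\}^n$, two $n$-tuples being adjacent if and only if they differ in exactly one coordinate. For a graph $G$ with no isolated vertices and a positive integer $k$, a $k$-coupon coloring of $G$ is an assignment of colors from $[k]$ to the vertices such that the neighborhood of every vertex contains vertices of all colors in $[k]$; the coupon coloring number $\chi_c(G)$ is the maximum $k$ for which a $k$-coupon coloring exists. An injective $k$-coloring of $G$ is an assignment of colors from $[k]$ to the vertices such that no two vertices joined by a path of length two in $G$ receive the same color; the injective coloring number $\chi_i(G)$ is the minimum $k$ for which such a coloring exists.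
   Formalization: In item 2 the case q = 2, k = 1 is excluded: there n = 1 and H_{1,2} is a single edge with no path of length two, so its injective coloring number is 1 and not q^k = 2. *)

(* Defs.v *)
From mathcomp Require Import all_boot.

Set Implicit Arguments.
Unset Strict Implicit.
Unset Printing Implicit Defensive.

Record sgraph := SGraph {
  vertex :> finType;
  adj : rel vertex;
  adj_sym : symmetric adj;
  adj_irr : irreflexive adj }.

Definition no_isolated (G : sgraph) : bool :=
  [forall x : G, exists y : G, adj x y].

Definition coupon_coloring (G : sgraph) (k : nat) (f : {ffun G -> 'I_k}) : bool :=
  [forall x : G, forall c : 'I_k, exists y : G, adj x y && (f y == c)].

Definition coupon_colorable (G : sgraph) (k : nat) : bool :=
  (0 < k) && [exists f : {ffun G -> 'I_k}, coupon_coloring f].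

(* The bound #|G| on k loses nothing on a nonempty graph, see [coupon_numberP];
   the value is junk when G is empty or has an isolated vertex. *)
Definition coupon_number (G : sgraph) : nat :=
  \max_(k < #|G|.+1 | coupon_colorable G k) k.

(* As [adj] is irreflexive, [x != z] makes x, y, z a path of length two. *)
Definition injective_coloring (G : sgraph) (k : nat) (f : {ffun G -> 'I_k}) : bool :=
  [forall x : G, forall y : G, forall z : G,
     [&& adj x y, adj y z & x != z] ==> (f x != f z)].

Definition injective_colorable (G : sgraph) (k : nat) : bool :=
  [exists f : {ffun G -> 'I_k}, injective_coloring f].

Lemma injective_colorable_card (G : sgraph) : injective_colorable G #|G|.
Proof.
apply/existsP; exists [ffun x => enum_rank x].
apply/forallP=> x; apply/forallP=> y; apply/forallP=> z.
apply/implyP=> /and3P[_ _ xz].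
by rewrite !ffunE (inj_eq enum_rank_inj).
Qed.

Lemma injective_colorable_ex (G : sgraph) : exists k, injective_colorable G k.
Proof. by exists #|G|; apply: injective_colorable_card. Qed.

Definition injective_number (G : sgraph) : nat :=
  ex_minn (injective_colorable_ex G).

Definition hamming_adj (n q : nat) : rel {ffun 'I_n -> 'I_q} :=
  fun x y => #|[set i | x i != y i]| == 1.

Lemma hamming_adj_sym n q : symmetric (@hamming_adj n q).
Proof.
by move=> x y; congr (_ == _); apply: eq_card => i; rewrite !inE eq_sym.
Qed.

Lemma hamming_adj_irr n q : irreflexive (@hamming_adj n q).
Proof.
move=> x; rewrite /hamming_adj (_ : [set i | _] = set0) ?cards0 //.
by apply/setP=> i; rewrite !inE eqxx.
Qed.

Definition hamming (n q : nat) : sgraph :=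
  SGraph (@hamming_adj_sym n q) (@hamming_adj_irr n q).

Definition prime_power (q : nat) : Prop :=
  exists p a, [/\ prime p, 0 < a & q = p ^ a].

Lemma coupon_colorable_le (G : sgraph) k :
  0 < #|G| -> coupon_colorable G k -> k <= #|G|.
Proof.
case/card_gt0P=> x _ /andP[_ /existsP[f /forallP/(_ x)/forallP fP]].
have fsurj c : c \in codom f.
  by have /existsP[y /andP[_ /eqP <-]] := fP c; apply: codom_f.
have -> : k = #|codom f| by rewrite -[LHS]card_ord; apply: eq_card => c; rewrite fsurj.
by rewrite -(size_codom f) card_size.
Qed.

Lemma coupon_numberP (G : sgraph) :
  0 < #|G| -> no_isolated G ->
  coupon_colorable G (coupon_number G) /\
  (forall k, coupon_colorable G k -> k <= coupon_number G).
Proof.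
move=> G0 noI; split; last first.
  move=> k kP; have kG := coupon_colorable_le G0 kP.
  by rewrite -[k]/(nat_of_ord (Ordinal (kG : k < #|G|.+1))); apply: leq_bigmax_cond.
have c1 : coupon_colorable G 1.
  apply/existsP; exists [ffun=> ord0].
  apply/forallP=> x; apply/forallP=> c.
  have /existsP[y xy] := forallP noI x.
  by apply/existsP; exists y; rewrite xy !ord1 eqxx.
pose i1 : 'I_#|G|.+1 := Ordinal (G0 : 1 < #|G|.+1).
rewrite /coupon_number (@bigop.bigmax_eq_arg _ i1) //.
by case: arg_maxnP.
Qed.

Lemma hamming_no_isolated n q : 0 < n -> 1 < q -> no_isolated (hamming n q).
Proof.
case: n => // n _; case: q => [|[|q]] // _; apply/forallP=> x.
pose c := if x ord0 == ord0 then ord_max else ord0 : 'I_q.+2.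
apply/existsP; exists [ffun i => if i == ord0 then c else x i].
apply/eqP/(@eq_card1 _ ord0) => i; rewrite !inE ffunE.
have [->|_] := eqVneq i ord0; last by rewrite eqxx.
by rewrite /c; have [->|] := eqVneq (x ord0) ord0.
Qed.

(* H_{1,2} is a single edge and has no path of length two: the formula
   [injective_number (hamming ((q ^ k - 1) %/ (q - 1)) q) = q ^ k] fails for
   (q, k) = (2, 1). *)
Lemma injective_number_hamming_1_2 : injective_number (hamming 1 2) = 1.
Proof.
have H1 : injective_colorable (hamming 1 2) 1.
  apply/existsP; exists [ffun=> ord0].
  apply/forallP=> x; apply/forallP=> y; apply/forallP=> z; apply/implyP.
  have E (a b : hamming 1 2) : (a == b) = (a ord0 == b ord0).
    apply/eqP/eqP=> [->//|ab]; apply/ffunP=> i.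
    by rewrite (ord1 i).
  have D (a b : hamming 1 2) : adj a b -> a ord0 != b ord0.
    by apply: contraTneq => /eqP; rewrite -E => /eqP->; rewrite adj_irr.
  have B (u v w : 'I_2) : u != v -> v != w -> u == w.
    by case: u => [[|[|]]//?]; case: v => [[|[|]]//?]; case: w => [[|[|]]//?].
  by case/and3P=> /D xy /D yz; rewrite E (B _ _ _ xy yz).
rewrite /injective_number; case: ex_minnP => m mP /(_ _ H1).
case: m mP => [|[|]] // /existsP[f _] _.
by case: (f [ffun=> ord0]).
Qed.

(* Main.v *)
Require Import Defs.
From mathcomp Require Import all_boot.
From mathcomp Require Import all_algebra all_field.

(** The colors seen in a neighborhood are distinct for an injective coloring and
exhaustive for a coupon coloring, so the degree n(q-1) bounds the first number of
colors from below and the second from above; on a d-regular graph an injective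
coloring with d colors is a coupon coloring, and then each of its color classes is a
perfect total dominating set, so d divides the number of vertices. For q > 2
every edge lies in a triangle, so even closed neighborhoods get distinct colors;
for q = 2 and n = 2^k - 1 the bound n is not attained since n is odd.

The upper bounds come from the syndrome x |-> \sum_i x_i v_i of a Hamming code,
the v_i being representatives of the points of a projective space: any two of
them are independent, so words at distance 1 or 2 get distinct syndromes.
Part 3 concatenates two such colorings. In part 1, vertices joined by a path of
length two are at distance exactly 2, so they still differ after a
coordinate is dropped, and the syndrome coloring in dimension n - 1 applies. *)

Set Implicit Arguments.
Unset Strict Implicit.
Unset Printing Implicit Defensive.

(** * Colorings and degrees in a general graph *)

Section Graphs.

Variable G : sgraph.
Implicit Types (x y z : G) (c d : nat).

Definition nbhd x : {set G} := [set y | adj x y].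

Lemma injective_coloring_nbhd c (f : {ffun G -> 'I_c}) :
  injective_coloring f -> forall x, {in nbhd x &, injective f}.
Proof.
move=> /forallP fP x y z; rewrite !inE => xy xz fyz.
apply/eqP/negPn/negP=> yz.
have /forallP/(_ x)/forallP/(_ z) := fP y.
by rewrite adj_sym xy xz yz fyz eqxx.
Qed.
Arguments injective_coloring_nbhd {c f} _ x [x1 x2] _ _ _ : rename.

Lemma leq_nbhd_injective c x : injective_colorable G c -> #|nbhd x| <= c.
Proof.
move=> /existsP[f /injective_coloring_nbhd/(_ x) fI].
by rewrite -(card_in_imset fI) -[leqRHS]card_ord max_card.
Qed.

(** A common neighbor [z] puts [x] and [y] in one neighborhood, so their colors differ and the
    coloring is injective on the closed neighborhood of [x]. *)
Lemma ltn_nbhd_injective c x :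
    (forall y, adj x y -> exists2 z, adj x z & adj z y) ->
  injective_colorable G c -> #|nbhd x| < c.
Proof.
move=> tri /existsP[f fP].
have fI : {in x |: nbhd x &, injective f}.
  have fx y : y \in nbhd x -> f x != f y.
    rewrite inE => xy; have [z xz zy] := tri y xy.
    apply: contraTneq xy => fxy.
    rewrite (injective_coloring_nbhd fP z _ _ fxy) ?adj_irr //.
      by rewrite inE adj_sym.
    by rewrite inE.
  move=> y z; rewrite !(inE, in_setU1) -![adj x _]in_set.
  case/predU1P=> [->|xy] /predU1P[->|xz] //.
  - by move/eqP; rewrite (negPf (fx z xz)).
  - by move/esym/eqP; rewrite (negPf (fx y xy)).
  - exact: (injective_coloring_nbhd fP x).
have xN : x \notin nbhd x by rewrite inE adj_irr.
rewrite -[_.+1]add1n; have := cardsU1 x (nbhd x); rewrite xN => <-.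
by rewrite -(card_in_imset fI) -[leqRHS]card_ord max_card.
Qed.

Lemma coupon_leq_nbhd c x : coupon_colorable G c -> c <= #|nbhd x|.
Proof.
move=> /andP[_ /existsP[f /forallP/(_ x)/forallP fP]].
rewrite -[c]card_ord -cardsT; apply: leq_trans (leq_imset_card f _).
apply/subset_leq_card/subsetP=> a _.
have /existsP[y /andP[xy /eqP<-]] := fP a.
by apply: imset_f; rewrite inE.
Qed.

(** Pigeonhole: [d] neighbors with distinct colors use up all [d] colors. *)
Lemma injective_coloring_nbhd_onto d (f : {ffun G -> 'I_d}) x a :
    #|nbhd x| = d -> injective_coloring f ->
  exists2 y, adj x y & f y = a.
Proof.
move=> dx fP; have fI := injective_coloring_nbhd fP x.
have : a \in [set f y | y in nbhd x].
  suff /eqP-> : [set f y | y in nbhd x] == setT by rewrite inE.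
  by rewrite eqEcard subsetT (card_in_imset fI) dx cardsT card_ord leqnn.
by case/imsetP=> y; rewrite inE => xy ->; exists y.
Qed.

Lemma injective_coupon_colorable d :
    0 < d -> (forall x, #|nbhd x| = d) ->
  injective_colorable G d -> coupon_colorable G d.
Proof.
move=> d_gt0 dG /existsP[f fP]; rewrite /coupon_colorable d_gt0.
apply/existsP; exists f; apply/forallP=> x; apply/forallP=> a.
have [y xy <-] := injective_coloring_nbhd_onto a (dG x) fP.
by apply/existsP; exists y; rewrite xy eqxx.
Qed.

(* Double counting of the edges that end in a fixed color class. *)
Lemma injective_regular_dvdn d :
    (forall x, #|nbhd x| = d) ->
  injective_colorable G d -> d %| #|G|.
Proof.
case: d => [|d] dG /existsP[f fP].
  (* Without colors only the empty graph can be colored. *)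
  rewrite dvd0n; apply/eqP/eq_card0 => x; by case: (f x).
pose C := [set y | f y == ord0].
(* Each vertex sends exactly one edge into [C], while each vertex of [C] receives [d.+1]. *)
have one x : #|[set y in C | adj x y]| = 1.
  have [y xy fy] := injective_coloring_nbhd_onto ord0 (dG x) fP.
  apply/eqP/cards1P; exists y; apply/setP=> z; rewrite !inE.
  apply/andP/eqP=> [[/eqP fz xz]|->]; last by rewrite fy.
  by apply: (injective_coloring_nbhd fP x); rewrite ?inE ?fz ?fy.
suff -> : #|G| = #|C| * d.+1 by apply: dvdn_mull.
have -> : #|G| = \sum_(x : G) \sum_(y in C | adj x y) 1.
  rewrite -sum1_card; apply: eq_bigr => x _.
  by rewrite -[LHS](one x) -sum1_card; apply: eq_bigl => y; rewrite !inE.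
rewrite (exchange_big_dep (mem C)) /=; last by move=> x y _ /andP[].
rewrite -sum_nat_const; apply: eq_bigr => y yC.
by rewrite -(dG y) -sum1_card; apply: eq_bigl => x; rewrite [y \in C]yC inE adj_sym.
Qed.

Lemma coupon_number_eq d :
    0 < #|G| -> 0 < d -> (forall x, #|nbhd x| = d) ->
  injective_colorable G d -> coupon_number G = d.
Proof.
move=> G_gt0 d_gt0 dG dP.
have dC := injective_coupon_colorable d_gt0 dG dP.
have /card_gt0P[x _] := G_gt0.
have noI : no_isolated G.
  apply/forallP=> y; have: 0 < #|nbhd y| by rewrite dG.
  by case/card_gt0P=> z; rewrite inE => yz; apply/existsP; exists z.
have [nC nmax] := coupon_numberP G_gt0 noI.
by apply/eqP; rewrite eqn_leq nmax // -(dG x) coupon_leq_nbhd.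
Qed.

Lemma injective_number_leq c : injective_colorable G c -> injective_number G <= c.
Proof. by rewrite /injective_number; case: ex_minnP => m _; apply. Qed.

Lemma injective_numberP : injective_colorable G (injective_number G).
Proof. by rewrite /injective_number; case: ex_minnP. Qed.

End Graphs.

(** * Neighborhoods in Hamming graphs *)

Lemma hammingP n q (x y : {ffun 'I_n -> 'I_q}) :
  reflect (exists2 i, x i != y i & forall j, j != i -> x j = y j)
          (hamming_adj x y).
Proof.
apply: (iffP cards1P) => [[i xy]|[i xyi xy]]; exists i.
- by have := set11 i; rewrite -xy inE.
- by move=> j; rewrite -in_set1 -xy inE negbK => /eqP.
- apply/setP=> j; rewrite !inE; have [->|/xy->] := eqVneq j i; first by rewrite xyi.
  by rewrite eqxx.
Qed.

Lemma card_nbhd_hamming n q (x : hamming n q) : #|nbhd x| = n * (q - 1).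
Proof.
case: q x => [|q] x.
  rewrite muln0; apply: eq_card0 => y; rewrite inE.
  by apply/hammingP=> -[i _ _]; case: (x i).
(* [lift (x j)] enumerates the letters other than [x j]. *)
pose nb (p : 'I_n * 'I_q) : hamming n q.+1 :=
  [ffun j => if j == p.1 then lift (x j) p.2 else x j].
have nbI : injective nb.
  move=> [i a] [j b] /ffunP E; have := E i; have := E j.
  rewrite !ffunE /= !eqxx; have [<-|_] := eqVneq j i.
    by move/lift_inj->.
  by move/eqP; rewrite (negPf (neq_lift _ _)).
have -> : nbhd x = [set nb p | p in setT].
  apply/setP=> y; rewrite inE; apply/hammingP/imsetP=> [[i xyi xy]|[[i a] _ ->]].
    have := unlift_some xyi => -[a ya _]; exists (i, a) => //.
    apply/ffunP=> j; rewrite ffunE /=.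
    by have [->|/xy] := eqVneq j i.
  exists i; first by rewrite ffunE eqxx neq_lift.
  by move=> j ji; rewrite ffunE (negPf ji).
by rewrite card_imset // cardsT card_prod !card_ord subn1.
Qed.

Lemma hamming_triangle n q (x y : hamming n q) :
  2 < q -> adj x y -> exists2 z : hamming n q, adj x z & adj z y.
Proof.
move=> q_gt2 /hammingP[i xyi xy].
(* A third letter in coordinate [i] gives the third vertex of the triangle. *)
have [a] : exists a, a \in ~: [set x i; y i].
  by apply/set0Pn; rewrite -card_gt0 cardsCs setCK card_ord cards2 xyi subn_gt0.
rewrite !inE negb_or => /andP[ax ay].
pose z : hamming n q := [ffun j => if j == i then a else x j].
exists z; apply/hammingP; exists i => [|j ji]; rewrite ffunE ?eqxx //.
- by rewrite eq_sym.
- by rewrite (negPf ji).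
- by rewrite (negPf ji) xy.
Qed.

(** * Colorings separating words at distance at most two *)

Definition diff (I A : finType) (x y : {ffun I -> A}) : {set I} :=
  [set i | x i != y i].

(** Each color class is a code of minimum distance at least 3. General finite types let a field
    serve as alphabet and a product as index set. *)
Definition separates (I A B : finType) (f : {ffun I -> A} -> B) :=
  forall x y, x != y -> #|diff x y| <= 2 -> f x != f y.

Definition separable (I A B : finType) :=
  exists f : {ffun I -> A} -> B, separates f.

Lemma card_leq_inj (A B : finType) :
  #|A| <= #|B| -> exists f : A -> B, injective f.
Proof.
move=> AB; exists (fun a => enum_val (widen_ord AB (enum_rank a))).
by move=> a b /enum_val_inj /(congr1 val) /= /ord_inj /enum_rank_inj.
Qed.

(** Renaming coordinates bijectively and letters injectively preserves distances; an injection of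
    colors keeps them distinct. *)
Lemma separable_card (I A B I' A' B' : finType) :
    #|I'| = #|I| -> #|A'| <= #|A| -> #|B| <= #|B'| ->
  separable I A B -> separable I' A' B'.
Proof.
move=> eqI /card_leq_inj[s sI] /card_leq_inj[t tI] [f fS].
have [u uI] : exists u : I -> I', injective u by apply: card_leq_inj; rewrite eqI.
have [v vK uK] : bijective u by apply: inj_card_bij; rewrite ?eqI.
exists (fun x => t (f [ffun i => s (x (u i))])) => x y xy D.
rewrite (inj_eq tI); apply: fS.
  apply: contra_neq xy => /ffunP E; apply/ffunP=> i.
  by have := E (v i); rewrite !ffunE uK => /sI.
apply: leq_trans D; rewrite -(card_imset _ uI).
apply/subset_leq_card/subsetP=> _ /imsetP[i + ->]; rewrite !inE !ffunE.
by rewrite (inj_eq sI).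
Qed.

(** Concatenation: [g] colors each block, and [f] colors the resulting word over [C]. A block where
    the words differ has at most two differences, so [g] sees it; at most two blocks differ, so [f]
    sees the outcome. *)
Lemma separable_prod (I J A C B : finType) :
  separable I C B -> separable J A C -> separable (I * J)%type A B.
Proof.
move=> [f fS] [g gS].
pose block (x : {ffun I * J -> A}) i := [ffun j => x (i, j)].
exists (fun x => f [ffun i => g (block x i)]) => x y xy D; apply: fS.
  have [[i j] xyij] : exists p, x p != y p.
    apply/existsP; apply: contraNT xy => /existsPn E; apply/eqP/ffunP=> p.
    by apply/eqP/negPn/E.
  apply: contra_neq (_ : g (block x i) != g (block y i)) => [/ffunP/(_ i)|].
    by rewrite !ffunE.
  apply: gS.
    by apply: contra_neq xyij => /ffunP/(_ j); rewrite !ffunE.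
  have pI : injective (pair i : J -> I * J) by move=> ? ? [].
  apply: leq_trans D; rewrite -(card_imset _ pI).
  by apply/subset_leq_card/subsetP=> _ /imsetP[l + ->]; rewrite !inE !ffunE.
apply: leq_trans D; apply: leq_trans (leq_imset_card fst _).
apply/subset_leq_card/subsetP=> i; rewrite inE !ffunE => gxy.
have [j xyij] : exists j, x (i, j) != y (i, j).
  apply/existsP; apply: contraNT gxy => /existsPn E; apply/eqP; congr g.
  by apply/ffunP=> j; rewrite !ffunE; apply/eqP/negPn/E.
by apply/imsetP; exists (i, j); rewrite ?inE.
Qed.

Lemma card_diff_path n q (x y z : {ffun 'I_n -> 'I_q}) :
  hamming_adj x y -> hamming_adj y z -> #|diff x z| <= 2.
Proof.
move=> /eqP xy /eqP yz; rewrite -[2]/(1 + 1) -{1}xy -yz.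
apply: leq_trans (leq_card_setU _ _).
apply/subset_leq_card/subsetP=> i; rewrite !inE -negb_and.
by apply: contraNN => /andP[/eqP-> /eqP->].
Qed.

Lemma separable_hamming n q c :
  separable 'I_n 'I_q 'I_c -> injective_colorable (hamming n q) c.
Proof.
move=> [f fS]; apply/existsP; exists [ffun x => f x].
apply/forallP=> x; apply/forallP=> y; apply/forallP=> z.
apply/implyP=> /and3P[xy yz xz]; rewrite !ffunE.
exact/fS/card_diff_path/yz/xy.
Qed.

Lemma hamming2_path_tail n (x y z : {ffun 'I_n.+1 -> 'I_2}) :
    hamming_adj x y -> hamming_adj y z -> x != z ->
  [ffun i => x (lift ord0 i)] != [ffun i => z (lift ord0 i)].
Proof.
move=> /hammingP[i xyi xy] /hammingP[j yzj yz]; apply: contra_neq => /ffunP E.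
have tail l : l != ord0 -> x l = z l.
  by rewrite eq_sym => /unlift_some[m -> _]; have := E m; rewrite !ffunE.
have B (a b c : 'I_2) : a != b -> b != c -> a = c.
  by move: a b c => [[|[|]]//?] [[|[|]]//?] [[|[|]]//?] _ _; apply: val_inj.
apply/ffunP=> l; have [->|] := eqVneq l ord0; last exact: tail.
(* If [i = j], the path changes at most one bit and restores it, so [x = z]. Otherwise [i] or [j] is
   nonzero, and [x] and [z] differ there, against [tail]. *)
have [ij|ij] := eqVneq i j.
  have [i0|i0] := eqVneq ord0 i; last by rewrite xy // yz // -ij.
  by rewrite i0; apply: B xyi _; rewrite ij.
have [i0|i0] := eqVneq i ord0; last first.
  by move: xyi; rewrite (tail i i0) (yz i ij) eqxx.
have j0 : j != ord0 by rewrite -i0 eq_sym.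
by move: yzj; rewrite -(tail j j0) (xy j) ?eqxx // eq_sym.
Qed.

Lemma separable_hamming2 n c :
  separable 'I_n 'I_2 'I_c -> injective_colorable (hamming n.+1 2) c.
Proof.
move=> [f fS]; apply/existsP.
exists [ffun x : hamming n.+1 2 => f [ffun i => x (lift ord0 i)]].
apply/forallP=> x; apply/forallP=> y; apply/forallP=> z.
apply/implyP=> /and3P[xy yz xz]; rewrite !ffunE; apply: fS.
  exact: hamming2_path_tail xy yz xz.
apply: leq_trans (card_diff_path xy yz); rewrite -(card_imset _ (@lift_inj _ ord0)).
by apply/subset_leq_card/subsetP=> _ /imsetP[i + ->]; rewrite !inE !ffunE.
Qed.

(** * Syndromes over a finite field *)

Section LinearColoring.

Import GRing.Theory.
Local Open Scope ring_scope.

Variable F : finFieldType.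

(* Representatives of the points of the projective space of dimension k - 1: the
   vectors whose first nonzero entry is 1. *)
Lemma projective_points k : exists (I : finType) (v : I -> 'rV[F]_k),
  [/\ (#|I| * (#|F| - 1) + 1 = #|F| ^ k)%N,
      forall i, v i != 0
    & forall i j a b, a != 0 -> a *: v i = b *: v j -> i = j].
Proof.
elim: k => [|k [I [v [cardI v0 vI]]]].
  by exists void, (fun i : void => 0); split=> [|[]|[]]; rewrite card_void.
have F_gt0 : (0 < #|F|)%N by apply/card_gt0P; exists 0.
(* Either the first entry is 0 and a point of lower dimension follows, or it is 1 and the rest is
   arbitrary. *)
pose w (s : I + 'rV[F]_k) : 'rV[F]_(1 + k) :=
  match s with inl i => row_mx 0 (v i) | inr u => row_mx 1%:M u end.
have scal_eq0 (a : F) : a%:M = 0 :> 'M_1 -> a = 0.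
  by move/matrixP/(_ 0 0); rewrite !mxE eqxx.
rewrite -[k.+1]add1n; exists (I + 'rV[F]_k)%type, w; split.
- rewrite card_sum card_mx mul1n mulnDl addnAC cardI.
  by rewrite -mulnS subn1 prednK // add1n expnSr.
- move=> [i|u] /=; rewrite -row_mx0; apply/eqP=> /eq_row_mx[].
    by move=> _ /eqP; rewrite (negPf (v0 i)).
  by move=> /scal_eq0/eqP; rewrite oner_eq0.
- move=> [i|u] [j|t] a b a0 /=; rewrite !scale_row_mx => /eq_row_mx[];
    rewrite ?scaler0 ?scalemx1.
  + by move=> _ /vI->.
  + move=> /esym/scal_eq0->; rewrite scale0r => /eqP.
    by rewrite scaler_eq0 (negPf a0) (negPf (v0 i)).
  + by move=> /scal_eq0 a_eq0; rewrite a_eq0 eqxx in a0.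
  + move=> /(congr1 (fun M : 'M_1 => M 0 0)); rewrite !mxE eqxx !mulr1n => <-.
    by move=> /(scalerI a0)->.
Qed.

(** The difference of two syndromes is a combination of at most two of the [v i] with nonzero
    coefficients, which independence keeps nonzero. *)
Lemma separable_syndrome (I : finType) k (v : I -> 'rV[F]_k) :
    (forall i, v i != 0) ->
    (forall i j a b, a != 0 -> a *: v i = b *: v j -> i = j) ->
  separable I F 'rV[F]_k.
Proof.
move=> v0 vI; exists (fun x => \sum_i x i *: v i) => x y xy D.
have [i xyi] : exists i, x i != y i.
  apply/existsP; apply: contraNT xy => /existsPn E; apply/eqP/ffunP=> i.
  by apply/eqP/negPn/E.
apply/negP; rewrite -subr_eq0 -sumrB.
under eq_bigr do rewrite -scalerBl.
rewrite (bigD1 i) //= addr_eq0 => /eqP E.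
have d0 : x i - y i != 0 by rewrite subr_eq0.
have : (#|diff x y :\ i| <= 1)%N.
  by move: D; rewrite (cardsD1 i) inE xyi.
(* If [i] is the only differing position, [E] makes a nonzero multiple of [v i] vanish; otherwise it
   makes one a multiple of [v j], with [j] the only other position. *)
case: (set_0Vmem (diff x y :\ i)) => [D0 _|[j jD] /card_le1_eqP D1].
  move: E; rewrite big1 => [/eqP|j ji].
    by rewrite oppr0 scaler_eq0 (negPf d0) (negPf (v0 i)).
  have : j \notin diff x y :\ i by rewrite D0 inE.
  by rewrite !inE ji negbK => /eqP->; rewrite subrr scale0r.
have ji : j != i by move: jD; rewrite !inE => /andP[].
move: E; rewrite (bigD1 j) //= big1 => [|l /andP[li lj]].
  by rewrite addr0 -scaleNr => /(vI _ _ _ _ d0) ij; rewrite ij eqxx in ji.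
have : l \notin diff x y :\ i by apply: contra_neqN lj => lD; apply: D1.
by rewrite !inE li negbK => /eqP->; rewrite subrr scale0r.
Qed.

End LinearColoring.

(** * Bounds for concrete parameters and the three statements *)

Lemma prime_power_gt1 q : prime_power q -> 1 < q.
Proof.
by case=> p [a [/prime_gt1 p_gt1 a_gt0 ->]]; rewrite -(expn0 p) ltn_exp2l.
Qed.

Lemma separable_prime_power q k : prime_power q ->
  separable 'I_((q ^ k - 1) %/ (q - 1)) 'I_q 'I_(q ^ k).
Proof.
move=> qP; have q_gt1 := prime_power_gt1 qP.
have [p [a [pp a_gt0 qE]]] := qP.
have [F _ cardF] := PrimePowerField pp a_gt0; rewrite -qE in cardF.
have [I [v [cardI v0 vI]]] := projective_points F k.
apply: separable_card (separable_syndrome v0 vI).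
- by rewrite card_ord -cardF -cardI addnK mulnK // cardF subn_gt0.
- by rewrite card_ord cardF.
- by rewrite card_mx mul1n card_ord cardF.
Qed.

Lemma predn_exp_divK q k : 1 < q -> (q ^ k - 1) %/ (q - 1) * (q - 1) = q ^ k - 1.
Proof.
by move=> q_gt1; rewrite divnK // !subn1 predn_exp dvdn_mulr.
Qed.

Lemma injective_hamming_gt n q c :
  2 < q -> injective_colorable (hamming n q) c -> n * (q - 1) < c.
Proof.
move=> q_gt2 cP; pose x : hamming n q := [ffun=> Ordinal (ltnW (ltnW q_gt2))].
rewrite -(card_nbhd_hamming x); apply: ltn_nbhd_injective cP => y.
exact: hamming_triangle.
Qed.

Lemma injective_hamming2_ge n c : injective_colorable (hamming n 2) c -> n <= c.
Proof.
move=> /(leq_nbhd_injective (([ffun=> ord0]) : hamming n 2)).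
by rewrite card_nbhd_hamming muln1.
Qed.

Lemma injective_hamming2_odd_gt n c :
  odd n -> 1 < n -> injective_colorable (hamming n 2) c -> n < c.
Proof.
move=> n_odd n_gt1 cP; rewrite ltn_neqAle (injective_hamming2_ge cP) andbT.
apply: contraTneq n_gt1 => nc; rewrite -nc in cP.
have deg (x : hamming n 2) : #|nbhd x| = n by rewrite card_nbhd_hamming muln1.
have := injective_regular_dvdn deg cP; rewrite card_ffun !card_ord => n_dvd.
(* An odd [n] is coprime to the number $2^n$ of vertices, which it divides, so [n = 1]. *)
have : coprime n (2 ^ n) by rewrite coprimeXr // coprimen2.
by rewrite /coprime (gcdn_idPl n_dvd) => /eqP->.
Qed.

Theorem theorem2 (k n q r : nat)
    (k_gt0 : 0 < k) (n_gt0 : 0 < n) (q_gt0 : 0 < q) (r_gt0 : 0 < r) :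
  [/\ q = 2 -> n = 2 ^ r ->
        coupon_number (hamming n q) = injective_number (hamming n q) /\
        injective_number (hamming n q) = n,
      prime_power q -> (q, k) <> (2, 1) -> n = (q ^ k - 1) %/ (q - 1) ->
        injective_number (hamming n q) = q ^ k
    & forall p m : nat, prime_power p -> prime_power q -> q ^ k <= p ->
        m = ((p ^ r - 1) %/ (p - 1)) * ((q ^ k - 1) %/ (q - 1)) ->
        injective_number (hamming m q) <= p ^ r].
Proof.
split=> [q2 nE|qP qk nE|p m pP qP qkp mE].
- have two : prime_power 2 by exists 2, 1.
  have nP : injective_colorable (hamming n 2) n.
    (* The code has length $2^r - 1 = n - 1$, one less than [n], and $2^r = n$ syndromes. *)
    have := separable_prime_power r two.
    rewrite -nE divn1; case: n n_gt0 {nE} => // n' _.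
    by rewrite subn1; apply: separable_hamming2.
  have iE : injective_number (hamming n 2) = n.
    apply/eqP; rewrite eqn_leq injective_number_leq //.
    exact/injective_hamming2_ge/injective_numberP.
  rewrite q2 iE; split=> //; apply: coupon_number_eq => // [|x].
    by rewrite card_ffun !card_ord expn_gt0.
  by rewrite card_nbhd_hamming muln1.
- have q_gt1 := prime_power_gt1 qP.
  have qk_gt0 : 0 < q ^ k by rewrite expn_gt0 q_gt0.
  (* Degree plus one is the number of syndromes, so for [2 < q] the closed neighborhood bound is
     sharp. *)
  have nqE : (n * (q - 1)).+1 = q ^ k by rewrite nE predn_exp_divK // subn1 prednK.
  apply/eqP; rewrite eqn_leq; apply/andP; split.
    apply/injective_number_leq/separable_hamming; rewrite nE.
    exact: separable_prime_power.
  have iP := injective_numberP (hamming n q).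
  rewrite -nqE; move: q_gt1; rewrite leq_eqVlt => /predU1P[q2|q_gt2]; last first.
    exact: injective_hamming_gt iP.
  rewrite -q2 muln1 in nqE iP qk *.
  (* Excluding the pair (2, 1) makes $n = 2^k - 1$ an odd number above 1. *)
  have k_gt1 : 1 < k by case: (k) k_gt0 qk => [|[]].
  apply: injective_hamming2_odd_gt => //.
    by apply: negbFE; rewrite -[~~ _]/(odd n.+1) nqE oddX (gtn_eqF k_gt0).
  have lt2k : 2 ^ 1 < 2 ^ k by rewrite ltn_exp2l.
  by rewrite -nqE in lt2k.
- apply/injective_number_leq/separable_hamming.
  (* The $q^k$ inner colors embed into the [p] letters of the outer code. *)
  have inner : separable 'I_((q ^ k - 1) %/ (q - 1)) 'I_q 'I_p.
    by apply: separable_card (separable_prime_power k qP); rewrite ?card_ord.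
  apply: separable_card (separable_prod (separable_prime_power r pP) inner);
    by rewrite ?card_prod !card_ord.
Qed.
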